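(* Let $K\ge2$ and $m\ge 2$ be integers, let $\mathcal{K}=(K_i)_{0\le i<m}$ be a partition of $\{0,\dots,K-1\}$ into nonempty sets, and let $\emptyset\ne P\subset Q_m$. Then $$\dim_H\{x\in\Sigma_K:\mu_{\mathcal{K}}(x)\cap P\ne\emptyset\}\le\sup g_{\mathcal{K}}(P)=\sup_{p\in P}g_{\mathcal K}(p).$$
   Context: $\Sigma_K=\{0,\dots,K-1\}^{\mathbb{N}}$ with $\mathbb{N}=\{0,1,2,\dots\}$, endowed with the metric $\rho(x,y)=K^{-\delta(x,y)}$, where $\delta(x,y)=\inf\{i\ge 0:x_i\ne y_i\}$ ($\rho(x,x)=0$). $\dim_H$ is Hausdorff dimension. $Q_m=\{p=(p_0,\dots,p_{m-1})\in[0,1]^m:\sum_{0\le i<m}p_i=1\}$, with the sup metric. The function $g_{\mathcal{K}}:Q_m\to[0,+\infty)$ is $$g_{\mathcal{K}}(p)=\frac{1}{\ln K}\sum_{0\le i<m}-p_i\ln\frac{p_i}{\#(K_i)},\qquad 0\ln 0=0.$$ For $x\in\Sigma_K$ and $n\ge1$, $\mu_{\mathcal{K},n}(x)\in Q_m$ is defined by $(\mu_{\mathcal{K},n}(x))_i=\frac1n\#\{0\le j<n:x_j\in K_i\}$ for $0\le i<m$, and $\mu_{\mathcal{K}}(x)\subset Q_m$ is the set of limit points of the sequence $(\mu_{\mathcal{K},n}(x))_{n\ge1}$, i.e. points every neighbourhood of which contains $\mu_{\mathcal{K},n}(x)$ for infinitely many $n$. *)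

(* Defs.v *)
From HB Require Import structures.
From mathcomp Require Import all_boot all_order all_algebra.
From mathcomp Require Import all_classical all_reals all_analysis.
Set Implicit Arguments.
Unset Strict Implicit.
Unset Printing Implicit Defensive.
Import Order.TTheory GRing.Theory Num.Theory.
Import numFieldNormedType.Exports.
Local Open Scope classical_set_scope.
Local Open Scope ring_scope.

Section hausdorff_dimension.
Context {R : realType} {T : metricType R}.
Implicit Types (A E U : set T) (s d : R).
Local Open Scope ereal_scope.

(* [ereal_sup set0] is [-oo]; the outer [maxe] makes the empty set have
   diameter 0. *)
Definition diam A : \bar R :=
  maxe 0 (ereal_sup [set (mdist x y)%:E | x in A & y in A]).

(* With [0 `^ 0 = 1], a nonempty set of diameter 0 has weight 1 when [s = 0],
   so the 0-dimensional Hausdorff measure is the counting measure. *)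
Definition diam_pow s U : \bar R :=
  if U == set0 then 0 else poweR (diam U) s.

Definition hausdorff_content s d E : \bar R :=
  ereal_inf [set \sum_(0 <= i <oo) diam_pow s (U i) | U in
    [set U : (set T)^nat |
       (forall i, diam (U i) <= d%:E) /\ E `<=` \bigcup_i U i]].

Definition hausdorff_measure s E : \bar R :=
  ereal_sup [set hausdorff_content s d E | d in [set d | (0 < d)%R]].

Definition hausdorff_dim E : \bar R :=
  ereal_inf [set s%:E | s in
    [set s | (0 <= s)%R /\ hausdorff_measure s E = 0]].

End hausdorff_dimension.

(* The metric below takes its values in [R], hence the phantom parameter. *)
Definition shift_space (R : realType) (K : nat) : Type := nat -> 'I_K.

HB.instance Definition _ (R : realType) (K : nat) :=
  Choice.copy (shift_space R K) (nat -> 'I_K).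

Section shift_metric.
Context {R : realType} {K : nat}.
Implicit Types x y z : shift_space R K.

(* [ex_minn h] is the first index at which [x] and [y] differ. *)
Definition shift_dist x y : R :=
  if pselect (exists i, x i != y i) is left h then K%:R ^- ex_minn h else 0.

Lemma shift_distxx x : shift_dist x x = 0.
Proof.
rewrite /shift_dist; case: pselect => // h.
by have [i] := h; rewrite eqxx.
Qed.

Lemma shift_size_gt0 x : (0 < K)%N.
Proof. exact: leq_ltn_trans (ltn_ord (x 0%N)). Qed.

Lemma shift_dist_ge0 x y : 0 <= shift_dist x y.
Proof.
by rewrite /shift_dist; case: pselect => // h; rewrite invr_ge0 exprn_ge0.
Qed.

Lemma shift_dist_eq0 x y : shift_dist x y = 0 -> x = y.
Proof.
rewrite /shift_dist; case: pselect => [h /eqP|h _].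
  by rewrite invr_eq0 expf_eq0 pnatr_eq0 eqn0Ngt (shift_size_gt0 x) andbF.
apply/funext => i; apply/eqP/negPn/negP => xyi.
by apply: h; exists i.
Qed.

Lemma shift_distC x y : shift_dist x y = shift_dist y x.
Proof.
rewrite /shift_dist; case: pselect => [h|h]; case: pselect => [h'|h'] //.
- by congr (_ ^- _); apply: eq_ex_minn => i /=; rewrite eq_sym.
- by case: h' ; case: h => i xy; exists i; rewrite eq_sym.
- by case: h ; case: h' => i xy; exists i; rewrite eq_sym.
Qed.

Lemma shift_dist_triangle y x z :
  shift_dist x z <= shift_dist x y + shift_dist y z.
Proof.
have K1 : 1 <= K%:R :> R by rewrite ler1n (shift_size_gt0 x).
rewrite {1}/shift_dist; case: pselect => [h|_]; last first.
  by rewrite addr_ge0 ?shift_dist_ge0.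
case: ex_minnP => n xzn _.
have aux (u v : shift_space R K) : u n != v n -> K%:R ^- n <= shift_dist u v.
  move=> uvn; rewrite /shift_dist; case: pselect => [h'|]; last first.
    by case; exists n.
  case: ex_minnP => k _ /(_ _ uvn) kn.
  rewrite lef_pV2 ?posrE ?exprn_gt0 ?(lt_le_trans ltr01)//.
  exact: ler_weXn2l.
have [xyn|xyn] := eqVneq (x n) (y n).
  by rewrite ler_wpDl ?shift_dist_ge0// aux// -xyn.
by rewrite ler_wpDr ?shift_dist_ge0// aux.
Qed.

HB.instance Definition _ := @isMetric.Build R (shift_space R K)
  shift_dist shift_distxx shift_dist_eq0 shift_distC shift_dist_triangle.

End shift_metric.

Definition simplex (R : realType) (m : nat) : set 'rV[R]_m :=
  [set p | (forall i, 0 <= p 0 i <= 1) /\ \sum_i p 0 i = 1].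
Arguments simplex : clear implicits.

Definition family_partition (K m : nat) (KK : 'I_m -> {set 'I_K}) : Prop :=
  [/\ forall i, (0 < #|KK i|)%N,
      forall i j k, k \in KK i -> k \in KK j -> i = j
    & forall k, exists i, k \in KK i].

Section partition_frequencies.
Context {R : realType} {K m : nat}.
Variable KK : 'I_m -> {set 'I_K}.

(* [ln 0 = 0] in the library, so the convention [0 ln 0 = 0] holds. *)
Definition entropy (p : 'rV[R]_m) : R :=
  (ln K%:R)^-1 * \sum_(i < m) - (p 0 i * ln (p 0 i / #|KK i|%:R)).

(* Meaningful for [0 < n]; the value at [n = 0] does not affect the limit
   points. *)
Definition freq (x : shift_space R K) (n : nat) : 'rV[R]_m :=
  \row_(i < m) (#|[pred j : 'I_n | x j \in KK i]|%:R / n%:R).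

(* The canonical topology on row vectors is that of the sup metric. *)
Definition freq_limits (x : shift_space R K) : set 'rV[R]_m :=
  simplex R m `&` cluster (freq x n @[n --> \oo]).

End partition_frequencies.

(* Main.v *)
Require Import Defs.
From mathcomp Require Import all_boot all_order all_algebra.
From mathcomp Require Import all_classical all_reals all_analysis.
From mathcomp Require Import lra.
Import Order.TTheory GRing.Theory Num.Theory.
Import numFieldNormedType.Exports.
Local Open Scope classical_set_scope.
Local Open Scope ring_scope.
Set Implicit Arguments.
Unset Strict Implicit.
Unset Printing Implicit Defensive.

(** Let [g] be the entropy and [s] a real number above its supremum on [P]. By
continuity of [g], a point having a limit frequency in [P] has infinitely many
prefixes whose frequency vector [q] satisfies [g q < s]. All words of length
[n] with frequency vector [q] have the same probability [K^(- n * g q)] under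
the i.i.d. measure giving mass [q_i / #K_i] to each letter of [K_i]. There are
at most [(n + 1)^m] frequency vectors of words of length [n], hence at most
[(n + 1)^m * K^(n * s)] words of length [n] with [g q < s]. The corresponding
cylinders with [n >= N] cover the set, and for [t > s] the sum of their
diameters to the power [t] is the tail of a convergent series. As no uniformity
over [P] is involved, compactness of the simplex is not needed. *)

(** * Diameters, Hausdorff content and countable covers *)

Lemma diam_ge0 (R : realType) (T : metricType R) (U : set T) : (0 <= diam U)%E.
Proof. by rewrite /diam le_max lexx. Qed.

Lemma diam_set0 (R : realType) (T : metricType R) : diam (@set0 T) = 0%E.
Proof.
rewrite /diam (_ : [set _ | _ in _ & _ in _] = set0) ?ereal_sup0 ?maxeNy//.
by rewrite -subset0 => z [].
Qed.

Lemma diam_subset (R : realType) (T : metricType R) (U V : set T) :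
  U `<=` V -> (diam U <= diam V)%E.
Proof.
move=> UV; rewrite /diam ge_max le_max lexx/= le_max; apply/orP; right.
apply: le_ereal_sup => _ [x /UV Vx [y /UV Vy <-]].
by exists x => //; exists y.
Qed.

Lemma diam_pow_ge0 (R : realType) (T : metricType R) (s : R) (U : set T) :
  (0 <= diam_pow s U)%E.
Proof. by rewrite /diam_pow; case: ifP => // _; exact: poweR_ge0. Qed.

Lemma diam_pow_le (R : realType) (T : metricType R) (s r : R) (U : set T) :
  0 <= s -> 0 <= r -> (diam U <= r%:E)%E -> (diam_pow s U <= (r `^ s)%:E)%E.
Proof.
move=> s0 r0 Ur; rewrite /diam_pow; case: ifP => _.
  by rewrite lee_fin powR_ge0.
rewrite -poweR_EFin; apply: gt0_ler_poweR => //.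
  by rewrite in_itv/= leey diam_ge0.
by rewrite in_itv/= leey lee_fin r0.
Qed.

Lemma hausdorff_content_ge0 (R : realType) (T : metricType R) (s d : R)
  (E : set T) : (0 <= hausdorff_content s d E)%E.
Proof.
apply: le_ereal_inf_tmp => _ [U _ <-].
by apply: nneseries_ge0 => n _ _; exact: diam_pow_ge0.
Qed.

Lemma hausdorff_content_le_esum (R : realType) (T : metricType R)
    (I : countType) (s d : R) (E : set T) (U : I -> set T) :
  0 <= d -> (forall i, diam (U i) <= d%:E)%E -> E `<=` \bigcup_i U i ->
  (hausdorff_content s d E <= \esum_(i in [set: I]) diam_pow s (U i))%E.
Proof.
move=> d0 Ud EU.
pose V k := if @pickle_inv I k is Some i then U i else set0.
have VU i : V (pickle i) = U i by rewrite /V pickleK_inv.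
have -> : (\esum_(i in [set: I]) diam_pow s (U i) =
    \sum_(0 <= k <oo) diam_pow s (V k))%E.
  rewrite nneseries_esumT; last by move=> k; exact: diam_pow_ge0.
  under eq_esum do rewrite -VU.
  rewrite -(esum_image [set: I] pickle (fun k => diam_pow s (V k))); last first.
    by move=> i j _ _; exact: (pcan_inj pickleK_inv).
  rewrite esum_mkcond; apply: eq_esum => k _.
  case: ifPn => // /negP ki; rewrite /V.
  case: pickle_inv (@pickle_invK I k) => [i /= ik|_].
    by exfalso; apply: ki; rewrite inE; exists i.
  by rewrite /diam_pow eqxx.
apply: ereal_inf_lbound; exists V => //; split.
  move=> k; rewrite /V; case: pickle_inv => [i//|].
  by rewrite diam_set0 lee_fin.
by move=> x /EU[i _ Uix]; exists (pickle i) => //; rewrite VU.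
Qed.

Lemma esum_tagged (R : realType) (I : nat -> finType)
    (a : {n & I n} -> \bar R) : (forall w, 0 <= a w)%E ->
  (\esum_(w in [set: {n & I n}]) a w =
   \sum_(0 <= n <oo) \sum_(f : I n) a (Tagged I f))%E.
Proof.
move=> a0.
have -> : [set: {n & I n}] = \bigcup_n [set Tagged I f | f in [set: I n]].
  by apply/seteqP; split => // -[n f] _; exists n => //; exists f.
rewrite nneseries_sum_bigcup//; last first.
  apply/trivIsetP => i j _ _ ij; rewrite -subset0 => _ [[f _ <-] [g _]].
  by move/(congr1 tag)/esym/eqP => /= /negPn; rewrite ij.
apply: eq_eseriesr => n _; rewrite esum_image; last first.
  by move=> f g _ _ /eqP; rewrite eq_Tagged => /eqP.
rewrite esum_fset//; last exact: finite_finset.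
rewrite (fsbigE (enum (I n))) ?enum_uniq//; last first.
  by move=> f _; rewrite mem_enum.
by rewrite big_enum_cond; apply: eq_bigl => f; rewrite in_setT.
Qed.

(** * Cylinder diameters and polynomial growth *)

Lemma shift_cylinder_diam (R : realType) (K n : nat) (f : 'I_n -> 'I_K) :
  (diam [set x : shift_space R K | forall j : 'I_n, x j = f j] <=
   (K%:R ^- n)%:E)%E.
Proof.
rewrite /diam ge_max lee_fin invr_ge0 exprn_ge0//=.
apply: ge_ereal_sup => _ [x xf] [y yf] <-; rewrite lee_fin.
rewrite /mdist /= /shift_dist; case: pselect => h; last first.
  by rewrite invr_ge0 exprn_ge0.
have K1 : 1 <= K%:R :> R by rewrite ler1n (shift_size_gt0 x).
case: ex_minnP => k xyk _.
rewrite lef_pV2 ?posrE ?exprn_gt0 ?(lt_le_trans ltr01)//.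
apply: ler_weXn2l => //; rewrite leqNgt; apply/negP => kn.
by move: xyk; rewrite (xf (Ordinal kn)) (yf (Ordinal kn)) eqxx.
Qed.

(** A single term of the exponential series at [e * n.+1] dominates the power up to a constant; the
    factor [expR e] absorbs the shift from [n.+1] to [n]. *)
Lemma expn_le_expR (R : realType) (m : nat) (e : R) : 0 < e ->
  exists2 C : R, 0 < C & forall n, n.+1%:R ^+ m <= C * expR (e * n%:R).
Proof.
case: m => [|m] e0.
  exists 1 => // n; rewrite expr0 mul1r -expR0 ler_expR mulr_ge0// ltW//.
have f0 : 0 < (m.+1)`!%:R :> R by rewrite ltr0n fact_gt0.
exists (expR e * (m.+1)`!%:R / e ^+ m.+1) => [|n].
  by rewrite divr_gt0 ?mulr_gt0 ?expR_gt0 ?exprn_gt0.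
have := @expR_ge1Dxn R (e * n.+1%:R) m (mulr_ge0 (ltW e0) (ler0n _ _)).
move=> /(le_trans (ler_wpDl ler01 (lexx _))); rewrite ler_pdivrMr//.
rewrite exprMn -ler_pdivlMl ?exprn_gt0// => /le_trans; apply.
by rewrite -(addn1 n) natrD mulrDr mulr1 expRD; lra.
Qed.

(** * Counting words by type *)

Definition occ {K m n : nat} (KK : 'I_m -> {set 'I_K}) (i : 'I_m)
  (f : {ffun 'I_n -> 'I_K}) : nat := #|[pred j | f j \in KK i]|.

Definition word_freq (R : realType) {K m n : nat} (KK : 'I_m -> {set 'I_K})
    (f : {ffun 'I_n -> 'I_K}) : 'rV[R]_m :=
  \row_i ((occ KK i f)%:R / n%:R).

Lemma partition_class (K m : nat) (KK : 'I_m -> {set 'I_K}) :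
  family_partition KK ->
  exists cl : 'I_K -> 'I_m, forall k i, (k \in KK i) = (cl k == i).
Proof.
case=> _ disj cov; have [cl clP] := choice cov.
exists cl => k i; apply/idP/eqP => [ki|<-//].
exact: disj (clP k) ki.
Qed.

Lemma occ_class (K m n : nat) (KK : 'I_m -> {set 'I_K}) (cl : 'I_K -> 'I_m)
    (f : {ffun 'I_n -> 'I_K}) i : (forall k i, (k \in KK i) = (cl k == i)) ->
  occ KK i f = (\sum_(j < n | cl (f j) == i) 1)%N.
Proof.
by move=> clP; rewrite sum1_card; apply: eq_card => j; rewrite !inE clP.
Qed.

(** Positions are grouped by class. Logarithmic weights [L] give the exponent of a word's
    probability, a constant [L] gives the total mass. *)
Lemma sum_occ (R : pzSemiRingType) (K m n : nat) (KK : 'I_m -> {set 'I_K})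
    (f : {ffun 'I_n -> 'I_K}) (cl : 'I_K -> 'I_m) (L : 'I_m -> R) :
  (forall k i, (k \in KK i) = (cl k == i)) ->
  \sum_i (occ KK i f)%:R * L i = \sum_(j < n) L (cl (f j)).
Proof.
move=> clP; rewrite [RHS](partition_big (fun j => cl (f j)) predT)//=.
apply: eq_bigr => i _; rewrite (occ_class _ _ clP) natr_sum mulr_suml.
by apply: eq_bigr => j /eqP ->; rewrite mul1r.
Qed.

(* [tau i] is the number of letters of class [i] in a word of length [n]. *)
Definition type_weight (R : realType) {K m n : nat} (KK : 'I_m -> {set 'I_K})
    (cl : 'I_K -> 'I_m) (tau : {ffun 'I_m -> 'I_n.+1}) (k : 'I_K) : R :=
  (tau (cl k))%:R / n%:R / #|KK (cl k)|%:R.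

(** Integer counts, rather than a real frequency vector, make types a finite type with [n.+1 ^ m]
    elements. *)
Definition word_type {K m n : nat} (KK : 'I_m -> {set 'I_K})
    (f : {ffun 'I_n -> 'I_K}) : {ffun 'I_m -> 'I_n.+1} :=
  [ffun i => inord (occ KK i f)].

Lemma word_typeE (K m n : nat) (KK : 'I_m -> {set 'I_K})
    (f : {ffun 'I_n -> 'I_K}) i : word_type KK f i = occ KK i f :> nat.
Proof.
by rewrite ffunE inordK// ltnS (leq_trans (max_card _))// card_ord.
Qed.

Lemma prod_type_weight (R : realType) (K m n : nat) (KK : 'I_m -> {set 'I_K})
    (cl : 'I_K -> 'I_m) (f : {ffun 'I_n -> 'I_K}) : (1 < K)%N ->
  (forall i, 0 < #|KK i|)%N ->
  (forall k i, (k \in KK i) = (cl k == i)) ->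
  \prod_j type_weight R KK cl (word_type KK f) (f j) =
  expR (- (n%:R * ln K%:R * entropy KK (word_freq R KK f))).
Proof.
move=> K1 KK0 clP.
case: (posnP n) => [n0|n0].
  by subst n; rewrite big_ord0 !mul0r oppr0 expR0.
pose L i : R := ln ((occ KK i f)%:R / n%:R / #|KK i|%:R).
(* The class met at position [j] has a nonzero count, so every factor is positive and is the
   exponential of its logarithm. *)
rewrite (eq_bigr (fun j => expR (L (cl (f j))))); last first.
  move=> j _; rewrite /type_weight word_typeE lnK// posrE.
  rewrite !divr_gt0 ?ltr0n//; apply/card_gt0P; exists j.
  by rewrite inE clP.
rewrite -expR_sum; congr expR; rewrite -(sum_occ _ _ clP).
have lnK0 : ln (K%:R : R) != 0 by rewrite gt_eqF// ln_gt0// ltr1n.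
rewrite /entropy mulrA mulfK// sumrN mulrN opprK mulr_sumr.
apply: eq_bigr => i _; rewrite mxE mulrA; congr (_ * _).
by rewrite mulrC divfK// pnatr_eq0 -lt0n.
Qed.

(** The mass of a class is spread evenly over its letters, and the class masses add up to 1 because
    the counts come from an actual word. *)
Lemma sum_type_weight (R : realType) (K m n : nat) (KK : 'I_m -> {set 'I_K})
    (cl : 'I_K -> 'I_m) (f : {ffun 'I_n -> 'I_K}) : (0 < n)%N ->
  (forall i, 0 < #|KK i|)%N ->
  (forall k i, (k \in KK i) = (cl k == i)) ->
  \sum_k type_weight R KK cl (word_type KK f) k = 1.
Proof.
move=> n0 KK0 clP; rewrite (partition_big cl predT)//=.
rewrite (eq_bigr (fun i => (occ KK i f)%:R * n%:R^-1)); last first.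
  move=> i _; rewrite /type_weight.
  rewrite (eq_bigr (fun=> (occ KK i f)%:R / n%:R / #|KK i|%:R)); last first.
    by move=> k /eqP ->; rewrite word_typeE.
  rewrite sumr_const (eq_card (B := KK i)); last by move=> k; rewrite clP.
  by rewrite -[LHS]mulr_natr divfK// pnatr_eq0 -lt0n.
rewrite (sum_occ _ _ clP) sumr_const card_ord -[LHS]mulr_natr mulVf//.
by rewrite pnatr_eq0 -lt0n.
Qed.

Lemma type_weight_ge0 (R : realType) (K m n : nat) (KK : 'I_m -> {set 'I_K})
    (cl : 'I_K -> 'I_m) (tau : {ffun 'I_m -> 'I_n.+1}) k :
  0 <= type_weight R KK cl tau k.
Proof. by rewrite !divr_ge0. Qed.

(* Each summand is at most the weight of [f] under the i.i.d. measure defined by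
its own type, and the weights for one fixed type sum to at most [1]. *)
Lemma sum_word_entropy_le (R : realType) (K m n : nat)
    (KK : 'I_m -> {set 'I_K}) (s : R) : (1 < K)%N -> (0 < n)%N ->
  family_partition KK ->
  \sum_(f : {ffun 'I_n -> 'I_K} | entropy KK (word_freq R KK f) < s)
    expR (- (n%:R * ln K%:R * s)) <= n.+1%:R ^+ m.
Proof.
move=> K1 n0 hKK; have [cl clP] := partition_class hKK.
have KK0 : forall i, (0 < #|KK i|)%N by case: hKK.
pose W (tau : {ffun 'I_m -> 'I_n.+1}) (f : {ffun 'I_n -> 'I_K}) :=
  \prod_j type_weight R KK cl tau (f j).
have W0 tau f : 0 <= W tau f by apply: prodr_ge0 => j _; exact: type_weight_ge0.
apply: (@le_trans _ _ (\sum_f W (word_type KK f) f)).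
  rewrite big_mkcond; apply: ler_sum => f _; case: ifPn => // fs.
  rewrite /W (prod_type_weight _ _ K1 KK0 clP)// ler_expR lerN2.
  apply: ler_wpM2l; last exact: ltW.
  by rewrite mulr_ge0// ln_ge0// ler1n ltnW.
rewrite (partition_big (word_type KK) predT)//=.
apply: (@le_trans _ _ (\sum_(tau : {ffun 'I_m -> 'I_n.+1}) 1)); last first.
  by rewrite sumr_const card_ffun !card_ord natrX.
apply: ler_sum => tau _.
(* A type realised by no word contributes an empty sum; a realised one gives letter weights of total
   mass 1. *)
have [[f0 <-]|no] := pselect
  (exists f0 : {ffun 'I_n -> 'I_K}, word_type KK f0 = tau); last first.
  by rewrite big_pred0// => f; apply/negP => /eqP ftau; apply: no; exists f.
apply: (@le_trans _ _ (\sum_f W (word_type KK f0) f)).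
  rewrite big_mkcond; apply: ler_sum => f _.
  by case: ifPn => // /eqP ->.
(* Distributivity turns the sum over words into a product over positions of total letter masses. *)
rewrite /W -(bigA_distr_bigA (fun=> type_weight R KK cl (word_type KK f0)))/=.
by rewrite (eq_bigr (fun=> 1)) ?big1_eq// => j _; exact: sum_type_weight.
Qed.

(** * Continuity and sign of the entropy *)

(** With [y = Num.sqrt x], the left side is [2 * y * (y * ln y^-1)], and [ln y^-1 < y^-1]. The bound
    gives continuity at 0. *)
Lemma xlnx_abs_le (R : realType) (x : R) :
  0 <= x <= 1 -> `|x * ln x| <= 2 * Num.sqrt x.
Proof.
move=> /andP[]; rewrite le_eqVlt => /predU1P[<- _|x0 x1].
  by rewrite mul0r normr0 sqrtr0 mulr0.
have s0 : 0 < Num.sqrt x by rewrite sqrtr_gt0.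
have xE : x = Num.sqrt x ^+ 2 by rewrite sqr_sqrtr// ltW.
rewrite ler0_norm; last by rewrite mulr_ge0_le0 ?ln_le0// ltW.
have -> : - (x * ln x) = Num.sqrt x * (2 * (Num.sqrt x * ln (Num.sqrt x)^-1)).
  by rewrite {1 2}xE lnXn// lnV ?posrE//; lra.
rewrite mulrC ler_wpM2r ?ltW//.
have : ln (Num.sqrt x)^-1 < (Num.sqrt x)^-1 by rewrite ln_sublinear// invr_gt0.
by rewrite -(ltr_pM2l s0) divff ?gt_eqF//; lra.
Qed.

(* [ln] vanishes on nonpositive reals, so continuity holds on the whole line. *)
Lemma xlnx_continuous (R : realType) : continuous (fun x : R => x * ln x).
Proof.
move=> x; have [x0|x0|<-] := ltgtP 0 x.
- apply: (@cvgM _ _ _ _ id (@ln R)); [exact: cvg_id|exact: continuous_ln].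
- rewrite /continuous_at [X in _ --> X](_ : _ = 0); last first.
    by rewrite ln0 ?mulr0// ltW.
  apply: cvg_near_cst; near=> y; rewrite ln0 ?mulr0// ltW//.
  by near: y; exact: lt_nbhsl.
- rewrite /continuous_at mul0r.
  have sq0 : 2 * Num.sqrt y @[y --> (0 : R)] --> (0 : R).
    rewrite -[X in _ --> X](mulr0 2) -{2}(sqrtr0 R).
    apply: cvgM; [exact: cvg_cst|exact: sqrt_continuous].
  apply: (@squeeze_cvgr _ (nbhs (0 : R)) _ _ (fun y => - (2 * Num.sqrt y))
    (fun y => 2 * Num.sqrt y)) => //.
    near=> y; rewrite -ler_norml.
    have [y0|y0] := leP 0 y; last first.
      by rewrite ln0 ?mulr0 ?normr0 ?mulr_ge0 ?sqrtr_ge0// ltW.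
    apply: xlnx_abs_le; rewrite y0/=.
    by near: y; apply: lt_le_nbhsl.
  by move/cvgN: sq0; rewrite oppr0; exact.
Unshelve. all: by end_near. Qed.

Lemma entropy_continuous (R : realType) (K m : nat) (KK : 'I_m -> {set 'I_K}) :
  (forall i, 0 < #|KK i|)%N -> continuous (@entropy R K m KK).
Proof.
move=> KK0 p.
have c i : {for p, continuous
    (fun q : 'rV[R]_m => q 0 i * ln (q 0 i / #|KK i|%:R))}.
  have k0 : #|KK i|%:R != 0 :> R by rewrite pnatr_eq0 -lt0n.
  (* Rescaling by [#|KK i|] reduces the summand to the function [x * ln x]. *)
  pose h (x : R) := #|KK i|%:R * (x / #|KK i|%:R * ln (x / #|KK i|%:R)).
  have -> : (fun q : 'rV[R]_m => q 0 i * ln (q 0 i / #|KK i|%:R)) =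
      h \o (fun q : 'rV[R]_m => q 0 i).
    by apply/funext => q; rewrite /h/= mulrA mulrCA divff// mulr1.
  apply: continuous_comp; first exact: coord_continuous.
  apply: (@continuousM _ _ (fun=> #|KK i|%:R)); first exact: cst_continuous.
  apply: (@continuous_comp _ _ _ (fun x : R => x / #|KK i|%:R)
    (fun x => x * ln x)); last exact: xlnx_continuous.
  apply: (@continuousM _ _ id (fun=> #|KK i|%:R^-1)) => //.
  exact: cst_continuous.
apply: (@continuousM _ _ (fun=> (ln K%:R)^-1)); first exact: cst_continuous.
apply: (@cvg_big _ _ +%R 0 xpredT (@add_continuous R) _ (nbhs p) _
  (fun i q => - (q 0 i * ln (q 0 i / #|KK i|%:R)))) => i _.
by apply: cvgN; exact: c.
Qed.

(** Each [p 0 i / #|KK i|] is at most 1, so its logarithm is nonpositive. This makes the exponents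
    used later nonnegative, as the definition of dimension demands. *)
Lemma entropy_ge0 (R : realType) (K m : nat) (KK : 'I_m -> {set 'I_K})
    (p : 'rV[R]_m) : (0 < K)%N -> (forall i, 0 < #|KK i|)%N ->
  simplex R m p -> 0 <= entropy KK p.
Proof.
move=> K0 KK0 [p01 _]; rewrite /entropy mulr_ge0 ?invr_ge0 ?ln_ge0 ?ler1n//.
apply: sumr_ge0 => i _; have /andP[pi0 pi1] := p01 i.
rewrite oppr_ge0 mulr_ge0_le0// ln_le0// ler_pdivrMr ?ltr0n// mul1r.
by rewrite (le_trans pi1)// ler1n.
Qed.

(** * Low-entropy prefixes and their cylinders *)

Lemma freq_limits_entropy_lt (R : realType) (K m : nat)
    (KK : 'I_m -> {set 'I_K}) (x : shift_space R K) (p : 'rV[R]_m) (s : R) :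
  (forall i, 0 < #|KK i|)%N -> freq_limits KK x p ->
  entropy KK p < s ->
  forall N, exists2 n, (N <= n)%N & entropy KK (freq KK x n) < s.
Proof.
move=> KK0 [_ clp] ps N.
(* The cluster property is applied to a tail of the frequency sequence and to the neighbourhood
   [entropy KK q < s] of [p]. *)
have [_ [[n Nn <-] ns]] : [set freq KK x n | n in [set n | (N <= n)%N]] `&`
    [set q | entropy KK q < s] !=set0.
  apply: clp.
    by exists N => // n Nn; exists n.
  exact: (entropy_continuous KK0 (x := p)) _ (lt_nbhsl ps).
by exists n.
Qed.

Lemma word_freq_prefix (R : realType) (K m n : nat) (KK : 'I_m -> {set 'I_K})
    (x : shift_space R K) :
  word_freq R KK [ffun j : 'I_n => x j] = freq KK x n.
Proof.
apply/rowP => i; rewrite !mxE; congr (_%:R / _).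
by apply: eq_card => j; rewrite !inE ffunE.
Qed.

(** The entropy bound sits inside the set: words of high entropy give the empty set, of weight 0, so
    all words can index the cover. *)
Definition low_entropy_cylinder (R : realType) {K m n : nat}
    (KK : 'I_m -> {set 'I_K}) (s : R) (f : {ffun 'I_n -> 'I_K}) :
    set (shift_space R K) :=
  [set x | entropy KK (word_freq R KK f) < s /\ forall j : 'I_n, x j = f j].

Lemma low_entropy_cylinder_diam (R : realType) (K m n : nat)
    (KK : 'I_m -> {set 'I_K}) (s : R) (f : {ffun 'I_n -> 'I_K}) :
  (diam (low_entropy_cylinder KK s f) <= (K%:R ^- n)%:E)%E.
Proof.
by apply: le_trans (shift_cylinder_diam R f); apply: diam_subset => x [].
Qed.

(** Each weight is at most [K^(- n * s) * K^(- n * (t - s))]; the first factors sum to at most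
    [n.+1 ^ m] by the count of words. *)
Lemma low_entropy_cylinder_weight (R : realType) (K m n : nat)
    (KK : 'I_m -> {set 'I_K}) (s t : R) : (1 < K)%N -> (0 < n)%N -> 0 <= t ->
  family_partition KK ->
  (\sum_(f : {ffun 'I_n -> 'I_K}) diam_pow t (low_entropy_cylinder KK s f) <=
   (n.+1%:R ^+ m * expR (- (n%:R * ln K%:R * (t - s))))%:E)%E.
Proof.
move=> K1 n0 t0 hKK.
have K0 : 0 < K%:R :> R by rewrite ltr0n ltnW.
apply: (@le_trans _ _ (\sum_(f : {ffun 'I_n -> 'I_K})
    (if entropy KK (word_freq R KK f) < s then
      expR (- (n%:R * ln K%:R * s)) * expR (- (n%:R * ln K%:R * (t - s)))
     else 0)%:E)%E).
  apply: lee_sum => f _; case: ifPn => fs; last first.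
    rewrite /diam_pow (_ : low_entropy_cylinder KK s f = set0) ?eqxx//.
    by rewrite -subset0 => x [fs' _]; rewrite fs' in fs.
  apply: le_trans (diam_pow_le t0 _ (low_entropy_cylinder_diam _ _ _)) _.
    by rewrite invr_ge0 exprn_ge0// ltW.
  rewrite lee_fin -expRD -opprD -mulrDr addrC subrK.
  rewrite /powR gt_eqF ?invr_gt0 ?exprn_gt0// ler_expR.
  have -> : ln (K%:R ^- n) = - (n%:R * ln K%:R) :> R.
    by rewrite lnV ?posrE ?exprn_gt0// lnXn// mulr_natl.
  by rewrite mulrN mulrC.
rewrite sumEFin lee_fin -big_mkcond/= -mulr_suml ler_wpM2r ?expR_ge0//.
exact: sum_word_entropy_le.
Qed.

(** * Vanishing of the Hausdorff measure *)

Lemma geometric_eseries (R : realType) (a q : R) : 0 < q -> q < 1 ->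
  (\sum_(0 <= n <oo) (a * q ^+ n)%:E = (a / (1 - q))%:E)%E.
Proof.
move=> q0 q1; apply/cvg_lim => //.
under eq_fun do rewrite sumEFin.
apply: cvg_EFin; first by apply: nearW.
by apply: (@cvg_geometric_series R a q); rewrite gtr0_norm.
Qed.

Lemma near_infty_expr_le (R : realType) (q e : R) : 0 < q -> q < 1 -> 0 < e ->
  \forall n \near \oo, q ^+ n <= e.
Proof.
move=> q0 q1 e0; have qn : q ^+ n @[n --> \oo] --> 0.
  by apply: cvg_expr; rewrite gtr0_norm.
exact: qn _ (lt_le_nbhsl e0).
Qed.

Lemma low_entropy_measure0 (R : realType) (K m : nat)
    (KK : 'I_m -> {set 'I_K}) (s t : R) (E : set (shift_space R K)) :
  (1 < K)%N -> family_partition KK -> 0 <= t -> s < t ->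
  (forall x, E x -> forall N, exists2 n, (N <= n)%N &
     entropy KK (freq KK x n) < s) ->
  hausdorff_measure t E = 0%E.
Proof.
move=> K1 hKK t0 st Es.
have K0 : 0 < K%:R :> R by rewrite ltr0n ltnW.
have lnK0 : 0 < ln K%:R :> R by rewrite ln_gt0// ltr1n.
have Kinv0 : 0 < K%:R^-1 :> R by rewrite invr_gt0.
have Kinv1 : K%:R^-1 < 1 :> R by rewrite invf_lt1// ltr1n.
(* Half of the exponential decay rate: one half absorbs the polynomial factor, the other is the rate
   of the geometric ratio [q]. *)
pose e := ln K%:R * (t - s) / 2.
have e0 : 0 < e by rewrite divr_gt0// mulr_gt0// subr_gt0.
have [C C0 Cn] := expn_le_expR m e0.
pose q := expR (- e).
have q1 : q < 1 by rewrite -expR0 ltr_expR oppr_lt0.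
have q0 : 0 < q by exact: expR_gt0.
have content_le d N : 0 < d -> (0 < N)%N -> K%:R ^- N <= d ->
    (hausdorff_content t d E <= (C * q ^+ N / (1 - q))%:E)%E.
  move=> d0 N0 Nd.
  (* Only lengths [N + n] occur, which keeps all diameters below [K^(- N) <= d]. *)
  pose U (w : {n & {ffun 'I_(N + n) -> 'I_K}}) :=
    low_entropy_cylinder KK s (tagged w).
  apply: le_trans (@hausdorff_content_le_esum _ _ _ t d E U (ltW d0) _ _) _.
  - move=> [n f]; apply: le_trans (low_entropy_cylinder_diam _ _ _) _.
    rewrite lee_fin (le_trans _ Nd)// lef_pV2 ?posrE ?exprn_gt0 ?ltr0n//
      1?ltnW//.
    by rewrite ler_weXn2l ?leq_addr// ler1n ltnW.
  - move=> x /Es /(_ N) [n /subnKC Nn ns].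
    move: ns; rewrite -Nn -word_freq_prefix => ns.
    exists (Tagged (fun n => {ffun 'I_(N + n) -> 'I_K})
      [ffun j : 'I_(N + (n - N)) => x j]) => //.
    by split => //= j; rewrite ffunE.
  - rewrite esum_tagged; last by move=> w; exact: diam_pow_ge0.
    rewrite -(geometric_eseries _ q0 q1).
    apply: lee_nneseries => [n _ _|n _].
      by apply: sume_ge0 => f _; exact: diam_pow_ge0.
    apply: le_trans (low_entropy_cylinder_weight _ K1 _ t0 hKK) _.
      by rewrite addn_gt0 N0.
    rewrite lee_fin -[leRHS]mulrA -exprD -expRM_natl.
    apply: le_trans (ler_wpM2r (expR_ge0 _) (Cn _)) _.
    rewrite -[leLHS]mulrA ler_pM2l// -expRD ler_expR.
    have -> : (N + n)%:R * ln K%:R * (t - s) = (N + n)%:R * (2 * e).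
      by rewrite -mulrA [2 * e]mulrC divfK.
    by move: (N + n)%:R (e) => k y; lra.
have content0 d : 0 < d -> hausdorff_content t d E = 0%E.
  move=> d0; apply/eqP; rewrite eq_le hausdorff_content_ge0 andbT.
  apply/lee_addgt0Pr => r r0; rewrite add0e.
  near \oo => N; apply: le_trans (content_le d N d0 _ _) _.
  - by near: N; exact: nbhs_infty_gt.
  - by rewrite -exprVn; near: N; exact: near_infty_expr_le.
  - rewrite lee_fin ler_pdivrMr ?subr_gt0// -ler_pdivlMl//.
    near: N; apply: near_infty_expr_le => //.
    by rewrite mulr_gt0 ?invr_gt0// mulr_gt0// subr_gt0.
apply/eqP; rewrite eq_le; apply/andP; split.
  by apply: ge_ereal_sup => _ [d d0 <-]; rewrite content0.
(* One scale, here 1, suffices to bound the supremum below by 0. *)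
by apply: ereal_sup_ubound; exists 1; rewrite ?content0/=.
Unshelve. all: by end_near. Qed.

Theorem lemma5p8 (R : realType) (K m : nat) (hK : (2 <= K)%N) (hm : (2 <= m)%N)
    (KK : 'I_m -> {set 'I_K}) (hKK : family_partition KK)
    (P : set 'rV[R]_m) (P0 : P !=set0) (PQ : P `<=` simplex R m) :
  (hausdorff_dim [set x : shift_space R K | freq_limits KK x `&` P !=set0]
     <= ereal_sup [set (entropy KK p)%:E | p in P])%E.
Proof.
have KK0 : forall i, (0 < #|KK i|)%N by case: hKK.
have supP p : P p ->
    ((entropy KK p)%:E <= ereal_sup [set (entropy KK p)%:E | p in P])%E.
  by move=> Pp; apply: ereal_sup_ubound; exists p.
have [p0 Pp0] := P0.
have sup0 : (0 <= ereal_sup [set (entropy KK p)%:E | p in P])%E.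
  apply: le_trans (supP _ Pp0); rewrite lee_fin.
  exact: entropy_ge0 (ltnW hK) KK0 (PQ _ Pp0).
(* An infinite supremum makes the bound trivial, and [sup0] excludes [-oo]. *)
case: ereal_sup sup0 supP => [r| |] // r0 supP; last by rewrite leey.
rewrite lee_fin in r0.
apply/lee_addgt0Pr => e e0; rewrite -EFinD.
apply: ereal_inf_lbound; exists (r + e) => //; split.
  by rewrite addr_ge0// ltW.
(* The threshold [r + e / 2] lies strictly between the supremum [r] of the entropies and the
   exponent [r + e]. *)
apply: (@low_entropy_measure0 _ _ _ KK (r + e / 2)) => //.
- by rewrite addr_ge0// ltW.
- by rewrite ltrD2l; lra.
- move=> x [p [xp Pp]] N; apply: freq_limits_entropy_lt xp _ N => //.
  have := supP _ Pp; rewrite lee_fin; lra.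
Qed.
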